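(* (String equations.) Let $\mu$ be a complex Borel measure on $\mathbb{T}^D$ with moment matrix $G$. For every multi-index $\alpha\in\mathbb{Z}^D$, $$\Upsilon_\alpha G=G\,\Upsilon_\alpha .$$
   Context: Let $D\ge1$, $z(\theta)=(e^{i\theta_1},\dots,e^{i\theta_D})$. For $\alpha\in\mathbb{Z}^D$ put $|\alpha|=\sum_a|\alpha_a|$ and $z^\alpha=\prod_a z_a^{\alpha_a}$. Multi-indices are ordered by $|\alpha|$ and, for equal $|\alpha|$, lexicographically; $\chi(z)$ is the semi-infinite column vector of all monomials $z^\alpha$ in this order, and semi-infinite matrices are indexed by $\mathbb{Z}^D$ in this order. The moment matrix is $G=\oint_{\mathbb{T}^D}\chi(z(\theta))\,d\mu(\theta)\,\chi(z(-\theta))^\top$, i.e. $G_{\beta,\gamma}=\oint e^{i(\beta-\gamma)\cdot\theta}d\mu(\theta)$. For $a\in\{1,\dots,D\}$ the spectral matrix $\Upsilon_a$ has entries $(\Upsilon_a)_{\beta,\gamma}=\delta_{\beta+e_a,\gamma}$, where $e_a$ is the $a$-th canonical vector; the $\Upsilon_a$ are commuting invertible (orthogonal) matrices, and $\Upsilon_\alpha=\prod_{a=1}^D(\Upsilon_a)^{\alpha_a}$ for $\alpha\in\mathbb{Z}^D$. *)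

(* Defs.v *)
From HB Require Import structures.
From mathcomp Require Import all_boot all_order all_algebra.
From mathcomp Require Import all_classical all_reals all_analysis.
From mathcomp.real_closed Require Import complex.

Set Implicit Arguments.
Unset Strict Implicit.
Unset Printing Implicit Defensive.

Import Order.TTheory GRing.Theory Num.Theory.
Import numFieldNormedType.Exports.

Local Open Scope classical_set_scope.
Local Open Scope ring_scope.

(* A complex measure on T is a {charge set T -> \bar R[i]}, i.e. a countably
   additive set function (for the norm topology of R[i]) that is finite on
   measurable sets. *)
Section complex_charge_parts.
Context d (T : measurableType d) (R : realType).
Variable mu : {charge set T -> \bar R[i]}.

Definition charge_Re (A : set T) : \bar R := (complex.Re (fine (mu A)))%:E.
Definition charge_Im (A : set T) : \bar R := (complex.Im (fine (mu A)))%:E.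

Lemma charge_part_sigma_additive (h : R[i] -> R) : h 0 = 0 ->
  {morph h : x y / x + y} -> (forall z, real_complex R `|h z| <= `|z|) ->
  semi_sigma_additive (fun A => (h (fine (mu A)))%:E).
Proof.
move=> h0 hD hle F mF tF mUF.
have hN x : h (- x) = - h x.
  by apply/eqP; rewrite -subr_eq0 opprK -hD addNr h0.
have mu_fin A : measurable A -> (fine (mu A))%:E = mu A.
  by move=> mA; rewrite fineK// fin_num_measure.
have sumE n : (\sum_(0 <= i < n) (h (fine (mu (F i))))%:E)%E =
    (h (\sum_(0 <= i < n) fine (mu (F i))))%:E.
  rewrite sumEFin; congr (_%:E).
  by elim/big_rec2: _ => [|i x y _ ->]; rewrite ?h0// hD.
have sumF n : (\sum_(0 <= i < n) mu (F i))%E =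
    (\sum_(0 <= i < n) fine (mu (F i)))%:E.
  by rewrite -sumEFin; apply: eq_bigr => i _; rewrite mu_fin.
have := @charge_semi_sigma_additive _ _ _ mu F mF tF mUF.
rewrite -(mu_fin _ mUF); under eq_fun do rewrite sumF.
move=> cvg_mu U; rewrite /= {1}/nbhs /= => /nbhs_ballP[e /= e0 eU].
have /cvg_mu : nbhs (fine (mu (\bigcup_n F n)))%:E
    [set x : \bar R[i] | U (h (fine x))%:E].
  rewrite {1}/nbhs /=; apply/nbhs_ballP; exists (real_complex R e).
    by rewrite /= ltcR.
  move=> w /= zw; apply: eU.
  rewrite /ball /= -hN -hD -ltcR.
  exact: le_lt_trans (hle _) zw.
by case=> N _ NU; exists N => // n /NU /=; rewrite sumE.
Qed.

Let charge_Re0 : charge_Re set0 = 0%E.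
Proof. by rewrite /charge_Re charge0. Qed.

Let charge_Re_fin A : measurable A -> charge_Re A \is a fin_num.
Proof. by []. Qed.

Let charge_Re_sigma_additive : semi_sigma_additive charge_Re.
Proof.
apply: (@charge_part_sigma_additive (@complex.Re R)) => //; first by case=> ? ? [].
exact: normc_ge_Re.
Qed.

HB.instance Definition _ := isCharge.Build _ _ _ charge_Re
  charge_Re0 charge_Re_fin charge_Re_sigma_additive.

Let charge_Im0 : charge_Im set0 = 0%E.
Proof. by rewrite /charge_Im charge0. Qed.

Let charge_Im_fin A : measurable A -> charge_Im A \is a fin_num.
Proof. by []. Qed.

Let charge_Im_sigma_additive : semi_sigma_additive charge_Im.
Proof.
apply: (@charge_part_sigma_additive (@complex.Im R)) => //; first by case=> ? ? [].
move=> z; have := normc_ge_Re (z * 'i%C); rewrite ReiNIm normrN normrM.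
by rewrite [`|'i%C|]normc_def /= expr0n expr1n add0r sqrtr1 mulr1.
Qed.

HB.instance Definition _ := isCharge.Build _ _ _ charge_Im
  charge_Im0 charge_Im_fin charge_Im_sigma_additive.

End complex_charge_parts.

(* Integral against a signed measure, through its Jordan decomposition. *)
Definition charge_integral d (T : measurableType d) (R : realType)
    (nu : {charge set T -> \bar R}) (f : T -> R) : R :=
  let nuPN := svalP (cid (svalP (cid (Hahn_decomposition nu)))) in
  (\int[jordan_pos nuPN]_x f x - \int[jordan_neg nuPN]_x f x)%R.

Definition complex_integral d (T : measurableType d) (R : realType)
    (mu : {charge set T -> \bar R[i]}) (f : T -> R[i]) : R[i] :=
  let f1 := fun x => complex.Re (f x) in
  let f2 := fun x => complex.Im (f x) in
  Complex
    (charge_integral (charge_Re mu) f1 - charge_integral (charge_Im mu) f2)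
    (charge_integral (charge_Re mu) f2 + charge_integral (charge_Im mu) f1).


(* T^D is the set of z in C^D with |z_a| = 1 for all a. The alias (R[i])^o is
   R[i] with the topology of its norm. *)
Section torus.
Variables (R : realType) (D : nat).

Definition torus_set : set 'rV[(R[i])^o]_D :=
  [set z | forall a, `|z ord0 a| = 1].

Definition torus : Type := set_type torus_set.

HB.instance Definition _ := Topological.on torus.

Lemma torus_one_subproof : (const_mx 1 : 'rV[(R[i])^o]_D) \in torus_set.
Proof. by rewrite inE => a; rewrite mxE normr1. Qed.

HB.instance Definition _ :=
  isPointed.Build torus (SigSub torus_one_subproof).

Definition borel_torus := g_sigma_algebraType (@open torus).

(* z(theta) = (e^(i theta_1), ..., e^(i theta_D)). *)
Definition zpoint (theta : 'rV[R]_D) : 'rV[R[i]]_D :=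
  \row_a Complex (cos (theta ord0 a)) (sin (theta ord0 a)).

(* On the torus, z(theta) |-> z(- theta) is the entrywise inverse (see zpointN). *)
Definition zopp (z : 'rV[R[i]]_D) : 'rV[R[i]]_D := map_mx GRing.inv z.

Lemma zpointN theta : zpoint (- theta) = zopp (zpoint theta).
Proof.
apply/rowP => a; rewrite !mxE cosN sinN.
set c := cos _; set s := sin _.
have cs1 : Complex c s * Complex c (- s) = 1 :> R[i].
  apply/eqP; rewrite eq_complex /=; apply/andP; split; apply/eqP.
    by rewrite mulrN opprK -!expr2 cos2Dsin2.
  by rewrite mulrN mulrC addNr.
have cs0 : Complex c s != 0 :> R[i].
  by apply: contra_eq_neq cs1 => ->; rewrite mul0r eq_sym oner_neq0.
by apply: (mulfI cs0); rewrite cs1 divff.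
Qed.

End torus.

(* Semi-infinite vectors and matrices are indexed directly by multi-indices: the
   order in which the multi-indices are listed does not affect the entries of
   sums and products. *)
Section semi_infinite.
Variables (R : realType) (D : nat).

Definition multi_index := 'rV[int]_D.
Implicit Types alpha beta gamma : multi_index.

Definition canonical_vec (a : 'I_D) : multi_index := delta_mx ord0 a.

Definition simatrix := multi_index -> multi_index -> R[i].
Implicit Types A B : simatrix.

Definition simx1 : simatrix := fun beta gamma => (beta == gamma)%:R.

(* The sum over a set with \in is the sum of the nonzero terms when there are
   finitely many of them, and 0 otherwise. Every product in which one factor has
   finitely many nonzero entries in each row and column is thus the usual one. *)
Definition simx_mul A B : simatrix := fun beta gamma =>
  \sum_(delta \in [set: multi_index]) A beta delta * B delta gamma.

(* Two-sided inverse, with junk value 1 if there is none. *)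
Definition simx_inv A : simatrix :=
  xget simx1 [set B | simx_mul A B = simx1 /\ simx_mul B A = simx1].

Definition simx_exp A (n : nat) : simatrix := iter n (simx_mul A) simx1.

Definition simx_expz A (m : int) : simatrix :=
  match m with
  | Posz n => simx_exp A n
  | Negz n => simx_exp (simx_inv A) n.+1
  end.

Definition Upsilon_ (a : 'I_D) : simatrix := fun beta gamma =>
  (beta + canonical_vec a == gamma)%:R.

Definition Upsilon alpha : simatrix :=
  \big[simx_mul/simx1]_(a < D) simx_expz (Upsilon_ a) (alpha ord0 a).

Definition chi (z : 'rV[R[i]]_D) (alpha : multi_index) : R[i] :=
  \prod_(a < D) z ord0 a ^ alpha ord0 a.

Definition moment_matrix (mu : {charge set (borel_torus R D) -> \bar R[i]}) :
    simatrix := fun beta gamma =>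
  complex_integral mu (fun z => chi (\val z) beta * chi (zopp (\val z)) gamma).

End semi_infinite.

Arguments simx1 {R D}.

(* Main.v *)
(* Every power product of the Upsilon_a is a translation matrix, so that
   Upsilon_alpha G and G Upsilon_alpha have the entries G_(beta + alpha, gamma)
   and G_(beta, gamma - alpha); these agree because G is a Toeplitz matrix. *)

Require Import Defs.
From HB Require Import structures.
From mathcomp Require Import all_boot all_order all_algebra.
From mathcomp Require Import all_classical all_reals all_analysis.
From mathcomp.real_closed Require Import complex.

Local Open Scope ring_scope.

Import GRing.Theory Num.Theory.

(** Evaluates the sums in [simx_mul]: the support lies in a singleton, so the default value 0 for
    infinite supports never arises. *)
Lemma fsbig_supp1 (V : nmodType) (I : choiceType) (F : I -> V) (d : I) :
  (forall x, x != d -> F x = 0) ->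
  \sum_(x \in [set: I]%classic) F x = F d.
Proof.
move=> F0; rewrite -(fsbig_widen [set d]%classic) ?fsbig_set1 // => x [_ /=].
by move=> /eqP /F0.
Qed.

Section translation_matrices.
Variables (R : realType) (D : nat).
Implicit Types (alpha beta gamma : multi_index D) (A : simatrix R D).

(** [Upsilon_ a] is by definition the case [alpha = canonical_vec a]. *)
Definition simx_shift alpha : simatrix R D :=
  fun beta gamma => (beta + alpha == gamma)%:R.

Lemma simx_mul_shiftl alpha A :
  simx_mul (simx_shift alpha) A = fun beta gamma => A (beta + alpha) gamma.
Proof.
apply/funext => beta; apply/funext => gamma.
rewrite /simx_mul (fsbig_supp1 _ _ _ (beta + alpha)) /simx_shift.
  by rewrite eqxx mul1r.
by move=> x; rewrite eq_sym => /negbTE ->; rewrite mul0r.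
Qed.

Lemma simx_mul_shiftr alpha A :
  simx_mul A (simx_shift alpha) = fun beta gamma => A beta (gamma - alpha).
Proof.
apply/funext => beta; apply/funext => gamma.
rewrite /simx_mul (fsbig_supp1 _ _ _ (gamma - alpha)) /simx_shift.
  by rewrite subrK eqxx mulr1.
by move=> x; rewrite -subr_eq0 opprB addrA subr_eq0 => /negbTE ->; rewrite mulr0.
Qed.

Lemma simx_shift0 : simx_shift 0 = simx1.
Proof. by apply/funext => beta; apply/funext => gamma; rewrite /simx_shift addr0. Qed.

Lemma simx_shiftD alpha beta :
  simx_mul (simx_shift alpha) (simx_shift beta) = simx_shift (alpha + beta).
Proof.
rewrite simx_mul_shiftl; apply/funext => x; apply/funext => y.
by rewrite /simx_shift addrA.
Qed.

(** Uniqueness of the inverse is read off entrywise, without associativity of [simx_mul]: row [beta]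
    of a right inverse is row [beta - alpha] of the product, hence of the identity. *)
Lemma simx_inv_shift alpha : simx_inv (simx_shift alpha) = simx_shift (- alpha).
Proof.
apply: xget_unique => [|B [+ _]].
  by rewrite /= !simx_shiftD subrr addNr simx_shift0.
rewrite simx_mul_shiftl => AB1; apply/funext => beta; apply/funext => gamma.
have /(congr1 (fun M => M (beta - alpha) gamma)) := AB1.
by rewrite subrK.
Qed.

Lemma simx_exp_shift alpha n : simx_exp (simx_shift alpha) n = simx_shift (alpha *+ n).
Proof.
rewrite /simx_exp; elim: n => [|n IHn]; first by rewrite simx_shift0.
by rewrite iterS IHn simx_shiftD mulrS.
Qed.

Lemma simx_expz_shift alpha m : simx_expz (simx_shift alpha) m = simx_shift (alpha *~ m).
Proof.
case: m => n; rewrite /simx_expz ?simx_inv_shift simx_exp_shift //.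
(* [Negz n] stands for -(n+1), in agreement with the exponent [n.+1] in [simx_expz]. *)
by rewrite NegzE mulrNz mulNrn.
Qed.

Lemma UpsilonE alpha : Upsilon R alpha = simx_shift alpha.
Proof.
(* With [alpha] expanded in canonical vectors on the right only, the product of powers and the sum
   of exponents are compared factor by factor. *)
rewrite {2}(_ : alpha = \sum_(a < D) canonical_vec a *~ alpha ord0 a).
  rewrite /Upsilon; elim/big_rec2: _ => [|a y x _ ->]; first by rewrite simx_shift0.
  by rewrite -[Upsilon_ _ a]/(simx_shift (canonical_vec a)) simx_expz_shift simx_shiftD.
rewrite [LHS]row_sum_delta; apply: eq_bigr => a _.
by apply/rowP => j; rewrite -scaler_int intz.
Qed.

(** Exponents may be negative, and the law of exponents over the integers fails at 0. *)
Lemma chiD (z : 'rV[R[i]]_D) alpha beta : (forall a, z ord0 a != 0) ->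
  chi z (alpha + beta) = chi z alpha * chi z beta.
Proof.
by move=> z0; rewrite /chi -big_split; apply: eq_bigr => a _; rewrite mxE expfzDr.
Qed.

Lemma chi_zopp (z : 'rV[R[i]]_D) alpha : chi (zopp z) alpha = chi z (- alpha).
Proof. by apply: eq_bigr => a _; rewrite !mxE exprz_inv. Qed.

Lemma torus_neq0 (z : borel_torus R D) a : (\val z : 'rV[R[i]]_D) ord0 a != 0.
Proof.
have /set_mem /(_ a) z1 := valP z.
by rewrite -normr_eq0 [X in X == _]z1 oner_eq0.
Qed.

(** Both integrands are the same function on the torus, the monomial with exponent
    [beta + alpha - gamma]. *)
Lemma moment_matrix_Toeplitz (mu : {charge set (borel_torus R D) -> \bar R[i]})
    alpha beta gamma :
  moment_matrix mu (beta + alpha) gamma = moment_matrix mu beta (gamma - alpha).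
Proof.
congr complex_integral; apply/funext => z.
rewrite !chi_zopp -!chiD; try exact: torus_neq0.
by rewrite opprB addrA.
Qed.

End translation_matrices.

Theorem proposition2p22 (R : realType) (D : nat) (D_ge1 : (1 <= D)%N)
    (mu : {charge set (borel_torus R D) -> \bar R[i]})
    (alpha : multi_index D) :
  simx_mul (Upsilon R alpha) (moment_matrix mu) =
  simx_mul (moment_matrix mu) (Upsilon R alpha).
Proof.
rewrite UpsilonE simx_mul_shiftl simx_mul_shiftr.
by apply/funext => beta; apply/funext => gamma; exact: moment_matrix_Toeplitz.
Qed.
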